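(* Let $R$ be a Prüfer domain of finite character. Then, for each injective $R$-module $G$ and for every multiplicative subset $S$ of $R$, the module $S^{-1}G$ is injective.
   Context: All rings are commutative with unity and all modules are unital. A ring is a valuation ring if its ideals are linearly ordered by inclusion; a Prüfer domain is an integral domain $R$ such that $R_P$ is a valuation ring for every maximal ideal $P$. A domain $R$ is of finite character if every non-zero element of $R$ is contained in only finitely many maximal ideals. For $S^{-1}G$, injectivity over $R$ and over $S^{-1}R$ are equivalent. *)

(* Defs.v *)
From HB Require Import structures.
From mathcomp Require Import all_boot all_algebra.
From mathcomp Require Import generic_quotient.
From mathcomp Require Import ring.
From mathcomp Require Import boolp classical_sets cardinality.

Set Implicit Arguments.
Unset Strict Implicit.
Unset Printing Implicit Defensive.

Import GRing.Theory.
Local Open Scope classical_set_scope.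
Local Open Scope ring_scope.
Local Open Scope quotient_scope.

(* Ring-theoretic subsets are boolean predicates; under the classical axioms  *)
(* of boolp these are exactly the arbitrary subsets.                          *)

(* Ideals are the R-submodules of R; unlike [idealr_closed], the unit ideal   *)
(* is allowed.                                                                *)
Definition is_ideal (R : comPzRingType) (I : {pred R}) : Prop :=
  submod_closed (I : {pred R^o}).

Definition maximal_ideal (R : comPzRingType) (P : {pred R}) : Prop :=
  [/\ is_ideal P, 1 \notin P &
      forall J : {pred R}, is_ideal J -> 1 \notin J ->
        {subset P <= J} -> {subset J <= P}].

Definition valuation_ring (R : comPzRingType) : Prop :=
  forall I J : {pred R}, is_ideal I -> is_ideal J ->
    {subset I <= J} \/ {subset J <= I}.

Definition finite_character (R : comPzRingType) : Prop :=
  forall x : R, x != 0 ->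
    finite_set [set P : R -> bool | maximal_ideal P /\ x \in P].

Definition injective_module (R : pzRingType) (G : lmodType R) : Prop :=
  forall (M N : lmodType R) (f : {linear M -> N}) (g : {linear M -> G}),
    injective f -> exists h : {linear N -> G}, forall x, h (f x) = g x.

Module Localization.

Section Denominators.
Variables (R : comPzRingType) (S : mulrClosed R).

Definition den := {s : R | s \in S}.
Definition den1 : den := exist _ 1 (rpred1 S).
Definition denM (s t : den) : den :=
  exist _ (sval s * sval t) (rpredM (valP s) (valP t)).

End Denominators.

Arguments den1 {R S}.

Section Module_.
Variables (R : comPzRingType) (S : mulrClosed R) (M : lmodType R).
Local Notation den := (den S).

Definition equivl (x y : M * den) : bool :=
  `[< exists2 t, t \in S & t *: (sval y.2 *: x.1) = t *: (sval x.2 *: y.1) >].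

Lemma equivl_refl : reflexive equivl.
Proof. by move=> x; apply/asboolP; exists 1 => //; exact: rpred1. Qed.

Lemma equivl_sym : symmetric equivl.
Proof.
by move=> x y; apply/asboolP/asboolP => -[t St e]; exists t.
Qed.

Lemma equivl_trans : transitive equivl.
Proof.
move=> [m2 s2] [m1 s1] [m3 s3] /asboolP [t /= St e] /asboolP [u /= Su e'].
apply/asboolP; exists (t * u * sval s2) => /=.
  by rewrite !rpredM // (valP s2).
move: e e'; rewrite !scalerA => e e'.
have -> : t * u * sval s2 * sval s3 = (u * sval s3) * (t * sval s2) by ring.
rewrite -scalerA e scalerA.
have -> : u * sval s3 * (t * sval s1) = (t * sval s1) * (u * sval s3) by ring.
by rewrite -scalerA e' scalerA; congr (_ *: _); ring.
Qed.

Canonical equivl_equiv := EquivRel equivl equivl_refl equivl_sym equivl_trans.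

Definition type := {eq_quot equivl}.

HB.instance Definition _ : EqQuotient _ equivl type := EqQuotient.on type.
HB.instance Definition _ := Choice.on type.

Definition frac (m : M) (s : den) : type := \pi_type (m, s).

Lemma frac_ind (P : type -> Prop) : (forall m s, P (frac m s)) -> forall x, P x.
Proof. by move=> H; elim/quotW=> -[m s]; exact: H. Qed.

Lemma fracP m s m' s' : frac m s = frac m' s' <->
  exists2 t, t \in S & t *: (sval s' *: m) = t *: (sval s *: m').
Proof.
split=> [/eqquotP /asboolP //|h].
by apply/eqquotP/asboolP.
Qed.

Definition add (x y : type) : type :=
  let: (m, s) := repr x in let: (n, t) := repr y in
  frac (sval t *: m + sval s *: n) (denM s t).
Definition opp (x : type) : type := let: (m, s) := repr x in frac (- m) s.
Definition scale (a : R) (x : type) : type :=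
  let: (m, s) := repr x in frac (a *: m) s.
Definition zero : type := frac 0 den1.

Lemma fracW (x : type) : frac (repr x).1 (repr x).2 = x.
Proof. by rewrite /frac -surjective_pairing reprK. Qed.

Lemma fracD m s n t :
  add (frac m s) (frac n t) = frac (sval t *: m + sval s *: n) (denM s t).
Proof.
rewrite /add; have := fracW (frac m s); have := fracW (frac n t).
case: (repr (frac m s)) (repr (frac n t)) => [m' s'] [n' t'] /=.
move=> /fracP [u Su eu] /fracP [v Sv ev]; apply/fracP.
exists (u * v); rewrite ?rpredM //=.
move: eu ev; rewrite !(scalerDr, scalerA) => eu ev; congr (_ + _).
  have -> : u * v * (sval s * sval t) * sval t' = (u * sval t * sval t') * (v * sval s).
    by ring.
  by rewrite -scalerA ev scalerA; congr (_ *: _); ring.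
have -> : u * v * (sval s * sval t) * sval s' = (v * sval s * sval s') * (u * sval t).
  by ring.
by rewrite -scalerA eu scalerA; congr (_ *: _); ring.
Qed.

Lemma fracN m s : opp (frac m s) = frac (- m) s.
Proof.
rewrite /opp; have := fracW (frac m s); case: (repr _) => [m' s'] /=.
move=> /fracP [u Su eu]; apply/fracP; exists u => //.
by rewrite !scalerN eu.
Qed.

Lemma fracZ a m s : scale a (frac m s) = frac (a *: m) s.
Proof.
rewrite /scale; have := fracW (frac m s); case: (repr _) => [m' s'] /=.
move=> /fracP [u Su eu]; apply/fracP; exists u => //.
move: eu; rewrite !scalerA => eu.
have -> : u * sval s * a = a * (u * sval s) by ring.
by rewrite -scalerA eu scalerA; congr (_ *: _); ring.
Qed.

Lemma frac_eq m s m' s' : sval s' *: m = sval s *: m' -> frac m s = frac m' s'.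
Proof. by move=> e; apply/fracP; exists 1; rewrite ?rpred1 ?e. Qed.

Lemma addA : associative add.
Proof.
elim/frac_ind=> m s; elim/frac_ind=> n t; elim/frac_ind=> p u.
rewrite !fracD; apply: frac_eq => /=; rewrite !(scalerDr, scalerA) addrA.
by congr (_ *: _ + _ *: _ + _ *: _); ring.
Qed.

Lemma addC : commutative add.
Proof.
elim/frac_ind=> m s; elim/frac_ind=> n t.
rewrite !fracD; apply: frac_eq => /=; rewrite !(scalerDr, scalerA) addrC.
by congr (_ *: _ + _ *: _); ring.
Qed.

Lemma add0l : left_id zero add.
Proof.
elim/frac_ind=> m s; rewrite fracD; apply: frac_eq => /=.
by rewrite scaler0 add0r scale1r mul1r.
Qed.

Lemma addNl : left_inverse zero opp add.
Proof.
elim/frac_ind=> m s; rewrite fracN fracD; apply: frac_eq => /=.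
by rewrite scalerN addNr !scaler0.
Qed.

HB.instance Definition _ := GRing.isZmodule.Build type addA addC add0l addNl.

Lemma frac_addE m s n t :
  frac m s + frac n t = frac (sval t *: m + sval s *: n) (denM s t).
Proof. exact: fracD. Qed.

Lemma scaleA a b x : scale a (scale b x) = scale (a * b) x.
Proof. by elim/frac_ind: x => m s; rewrite !fracZ scalerA. Qed.

Lemma scale1 : left_id 1 scale.
Proof. by elim/frac_ind=> m s; rewrite fracZ scale1r. Qed.

Lemma scaleDr : right_distributive scale +%R.
Proof.
move=> a; elim/frac_ind=> m s; elim/frac_ind=> n t.
rewrite frac_addE !fracZ frac_addE; apply: frac_eq => /=.
rewrite !(scalerDr, scalerA).
by congr (_ *: _ + _ *: _); ring.
Qed.

Lemma scaleDl x : {morph scale^~ x : a b / a + b}.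
Proof.
move=> a b; elim/frac_ind: x => m s.
rewrite !fracZ frac_addE; apply: frac_eq => /=.
rewrite -scalerDr !scalerA -scalerDl !scalerA.
by congr (_ *: _); ring.
Qed.

HB.instance Definition _ :=
  GRing.Zmodule_isLmodule.Build R type scaleA scale1 scaleDr scaleDl.

End Module_.

Section Ring.
Variables (R : comPzRingType) (S : mulrClosed R).

Definition ring := type S R^o.
Local Notation frac := (frac (M := R^o)).

HB.instance Definition _ := GRing.Lmodule.on ring.

Definition one : ring := frac (1 : R) den1.
Definition mul (x y : ring) : ring :=
  let: (a, s) := repr x in let: (b, t) := repr y in
  frac ((a : R) * (b : R)) (denM s t).

Lemma fracM (a b : R) s t :
  mul (frac a s) (frac b t) = frac (a * b) (denM s t).
Proof.
rewrite /mul; have := fracW (frac a s); have := fracW (frac b t).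
case: (repr (frac a s)) (repr (frac b t)) => [a' s'] [b' t'] /=.
move=> /fracP [u Su eu] /fracP [v Sv ev]; apply/fracP.
exists (u * v); rewrite ?rpredM //=.
move: eu ev; rewrite /GRing.scale /= => eu ev.
have -> : u * v * (sval s * sval t * (a' * b')) =
  (v * (sval s * a')) * (u * (sval t * b')) by ring.
by rewrite eu ev; ring.
Qed.

Lemma mulA : associative mul.
Proof.
elim/frac_ind=> a s; elim/frac_ind=> b t; elim/frac_ind=> c u.
rewrite !fracM; apply: frac_eq; rewrite /GRing.scale /=; ring.
Qed.

Lemma mulC : commutative mul.
Proof.
elim/frac_ind=> a s; elim/frac_ind=> b t.
rewrite !fracM; apply: frac_eq; rewrite /GRing.scale /=; ring.
Qed.

Lemma mul1l : left_id one mul.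
Proof.
elim/frac_ind=> a s.
rewrite !fracM; apply: frac_eq; rewrite /GRing.scale /=; ring.
Qed.

Lemma mulDl : left_distributive mul +%R.
Proof.
elim/frac_ind=> a s; elim/frac_ind=> b t; elim/frac_ind=> c u.
rewrite frac_addE !fracM frac_addE; apply: frac_eq.
rewrite /GRing.scale /=; ring.
Qed.

HB.instance Definition _ :=
  GRing.Zmodule_isComPzRing.Build ring mulA mulC mul1l mulDl.

End Ring.

End Localization.
HB.export Localization.

(* S^{-1}M, with the R-module structure a *: (m / s) = (a *: m) / s. *)
Definition loc_module (R : comPzRingType) (S : mulrClosed R) (M : lmodType R)
  : lmodType R := Localization.type S M.

(* S^{-1}R; it is the zero ring when 0 is in S. *)
Definition loc_ring (R : comPzRingType) (S : mulrClosed R) : comPzRingType :=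
  Localization.ring S.

Lemma maximal_ideal_compl_mulr_closed (R : comPzRingType) (P : {pred R}) :
  maximal_ideal P -> mulr_closed [predC P].
Proof.
move=> [[P0 Plin] P1 Pmax]; split=> [|x y]; rewrite !inE => //.
have PM (a p : R) : p \in P -> a * p \in P.
  by move=> Pp; rewrite -[a * p]addr0; apply: (Plin a p 0).
have PD (p q : R) : p \in P -> q \in P -> p + q \in P.
  by move=> Pp Pq; rewrite -[p]mul1r; apply: (Plin 1 p q).
move=> Px Py; apply: contra Px => Pxy.
pose J : {pred R} := fun z => `[< exists2 p, p \in P & exists a, z = p + a * x >].
have inJ z : reflect (exists2 p, p \in P & exists a, z = p + a * x) (z \in J).
  exact: asboolP.
have Jx : x \in J by apply/inJ; exists 0 => //; exists 1; rewrite add0r mul1r.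
have [/inJ [p Pp [a e]]|J1] := boolP (1 \in J).
  case/negP: Py; have -> : y = y * p + a * (x * y).
    by rewrite -[LHS]mulr1 e; ring.
  by apply: PD; apply: PM.
apply: (Pmax J) => //; last first.
  by move=> p Pp; apply/inJ; exists p => //; exists 0; rewrite mul0r addr0.
split; first by apply/inJ; exists 0 => //; exists 0; rewrite mul0r addr0.
move=> c z w /inJ [p Pp [a ->]] /inJ [q Pq [b ->]]; apply/inJ.
exists (c * p + q); first by apply: PD => //; apply: PM.
by exists (c * a + b); rewrite /GRing.scale /=; ring.
Qed.

Definition maximal_ideal_compl (R : comPzRingType) (P : {pred R})
    (hP : maximal_ideal P) : mulrClosed R :=
  HB.pack_for (mulrClosed R) ([predC P] : R -> bool)
    (GRing.isMulClosed.Build R [predC P] (maximal_ideal_compl_mulr_closed hP)).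

Definition loc_at_maximal (R : comPzRingType) (P : {pred R})
    (hP : maximal_ideal P) : comPzRingType :=
  loc_ring (maximal_ideal_compl hP).

Definition prufer_domain (R : idomainType) : Prop :=
  forall (P : {pred R}) (hP : maximal_ideal P),
    valuation_ring (loc_at_maximal hP).

(* Main.v *)
(* Let T be the S-torsion of G, so that S^-1 G = G / T as G is divisible. By    *)
(* Baer's criterion we must extend f : I -> G / T to R; let a be a non-zero     *)
(* element of I and P_1, ..., P_n the maximal ideals containing a. Then G is a  *)
(* finite direct sum of submodules C_0, ..., C_n, where a acts injectively on   *)
(* C_0 and R \ P_i acts injectively on C_i: each C_i is a maximal such          *)
(* submodule of what is left, and an element of the remainder would have a      *)
(* non-zero multiple whose annihilator lies in no maximal ideal. It suffices to *)
(* treat each component of f. On C_0 divisibility is enough. On C_i the ring    *)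
(* may be replaced by the valuation ring R_{P_i}; if I is principal after       *)
(* inverting S, divisibility is again enough. Otherwise every x in I is c y     *)
(* with y in I and c killing the torsion of C_i, so that c f(y) is a            *)
(* well-defined element of C_i; this lifts f to I -> C_i, and the lift extends  *)
(* to R because G is injective.                                                 *)
Require Import Defs.
From HB Require Import structures.
From mathcomp Require Import all_boot all_algebra.
From mathcomp Require Import ring.
From mathcomp Require Import boolp classical_sets cardinality.

Set Implicit Arguments.
Unset Strict Implicit.
Unset Printing Implicit Defensive.

Import GRing.Theory.
Local Open Scope classical_set_scope.
Local Open Scope ring_scope.

(** Since [G] is divisible, S^-1 G is [G] modulo its S-torsion T, so by [baer] a map f from an ideal
    I to G/T must be extended to R. Fix a non-zero a in I. [torsion_free_decomposition] splits off
    summands of [G] on which a, or the complement of one of the finitely many maximal ideals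
    containing a, acts injectively; by [killed_common_multiple] nothing remains. On the first
    summand it suffices to divide f(a) by a ([extends_principal]). On the others R behaves like a
    valuation ring ([extends_valuation]): either I becomes principal once S is inverted, or each
    element of I is a multiple of another one by a factor killing the torsion, so that f lifts to
    the summand and injectivity of [G] applies. *)

(** * Submodules and Zorn's lemma *)

Section Submodules.
Variables (R : pzRingType) (M : lmodType R).
Implicit Types (A B Phi : set M) (x y z : M).

Definition submodule A := A 0 /\ forall r x y, A x -> A y -> A (r *: x + y).

Definition adjoin A z : set M :=
  [set x | exists2 a, A a & exists r, x = a + r *: z].

Lemma submodule_adjoin A z : submodule A -> submodule (adjoin A z).
Proof.
move=> [A0 AL]; split; first by exists 0 => //; exists 0; rewrite scale0r addr0.
move=> r _ _ [a Aa [s ->]] [b Ab [t ->]]; exists (r *: a + b); first exact: AL.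
by exists (r * s + t); rewrite scalerDl scalerDr scalerA addrACA.
Qed.

Lemma submoduleZ A r x : submodule A -> A x -> A (r *: x).
Proof. by move=> [A0 AL] Ax; rewrite -[_ *: _]addr0; apply: AL. Qed.

Lemma submoduleD A x y : submodule A -> A x -> A y -> A (x + y).
Proof. by move=> [A0 AL] Ax Ay; rewrite -[x]scale1r; apply: AL. Qed.

Lemma submoduleB A x y : submodule A -> A x -> A y -> A (x - y).
Proof. by move=> [A0 AL] Ax Ay; rewrite addrC -scaleN1r; apply: AL. Qed.

Lemma submodule_zero : submodule [set 0].
Proof. by split=> // r x y -> ->; rewrite scaler0 addr0. Qed.

(** [Phi] is arbitrary, so that this one use of Zorn serves for torsion-free submodules,
    complements, functional graphs and proper ideals. *)
Lemma maximal_submodule A0 Phi : submodule A0 -> A0 `<=` Phi ->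
  exists A, [/\ submodule A, A0 `<=` A, A `<=` Phi &
    forall z, (forall a r, A a -> Phi (a + r *: z)) -> A z].
Proof.
move=> sA0 A0Phi.
(* Zorn_bigcup also asks for the empty chain, hence the union with A0 *)
pose P A := submodule (A `|` A0) /\ A `|` A0 `<=` Phi.
have [F FP Ftot|A [[sA APhi] Amax]] := @Zorn_bigcup M P.
  split; last first.
    by move=> x [[X FX Xx]|/A0Phi//]; apply: (FP X FX).2; left.
  split; first by right; exact: sA0.1.
  move=> r x y [[X FX Xx]|Ax] [[Y FY Yy]|Ay]; last by right; apply: sA0.2.
  - have [XY|YX] := Ftot X Y FX FY.
      have [|?] := (FP Y FY).1.2 r x y (or_introl (XY _ Xx)) (or_introl Yy).
        by left; exists Y.
      by right.
    have [|?] := (FP X FX).1.2 r x y (or_introl Xx) (or_introl (YX _ Yy)).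
      by left; exists X.
    by right.
  - have [|?] := (FP X FX).1.2 r x y (or_introl Xx) (or_intror Ay).
      by left; exists X.
    by right.
  - have [|?] := (FP Y FY).1.2 r x y (or_intror Ax) (or_introl Yy).
      by left; exists Y.
    by right.
exists (A `|` A0); split=> // z Hz.
have sB := submodule_adjoin z sA.
have AB : A `|` A0 `<=` adjoin (A `|` A0) z.
  by move=> a Aa; exists a => //; exists 0; rewrite scale0r addr0.
have BA0 : adjoin (A `|` A0) z `|` A0 = adjoin (A `|` A0) z.
  by apply/seteqP; split=> x; [case=> // ?; apply: AB; right|left].
apply: contrapT => nAz; apply: (Amax (adjoin (A `|` A0) z)).
  split; first by move=> x Ax; apply: AB; left.
  move=> BA; apply: nAz; left; apply: BA.
  by exists 0; [exact: sA.1|exists 1; rewrite add0r scale1r].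
rewrite /P BA0; split=> // _ [a Aa [r ->]]; exact: Hz.
Qed.

Section Subtype.
Variables (A : set M) (sA : submodule A).

(** The proof is a dummy argument, kept in the term so that the instance below can recover it. *)
Definition submodule_pred of submodule A : {pred M} := fun x => `[< A x >].

Lemma submodule_pred_closed : submod_closed (submodule_pred sA).
Proof.
split; first by apply/asboolP; exact: sA.1.
by move=> r x y /asboolP Ax /asboolP Ay; apply/asboolP; apply: sA.2.
Qed.

HB.instance Definition _ := GRing.isSubmodClosed.Build R M
  (submodule_pred sA) submodule_pred_closed.

Definition submodule_type := {x : M | x \in submodule_pred sA}.

HB.instance Definition _ := SubChoice.on submodule_type.
HB.instance Definition _ := [SubChoice_isSubLmodule of submodule_type by <:].

End Subtype.
End Submodules.

(** * Injectivity through graphs; Baer's criterion *)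

Section Extension.
Variable R : pzRingType.

(** The graph [H] is itself a module whose first projection is injective; extend the second
    projection along it. *)
Lemma injective_extension (G N : lmodType R) (H : set (N * G)) :
  injective_module G -> submodule H -> (forall w, H (0, w) -> w = 0) ->
  exists h : {linear N -> G}, forall n w, H (n, w) -> h n = w.
Proof.
move=> hG sH H0; pose M := submodule_type sH.
have lf : linear (fun x : M => (val x).1) by [].
have lg : linear (fun x : M => (val x).2) by [].
pose f : {linear M -> N} := HB.pack (fun x : M => (val x).1)
  (GRing.isLinear.Build _ _ _ _ _ lf).
pose g : {linear M -> G} := HB.pack (fun x : M => (val x).2)
  (GRing.isLinear.Build _ _ _ _ _ lg).
have finj : injective f.
  move=> x y /= exy; apply: val_inj; rewrite [LHS]surjective_pairing.
  rewrite [RHS]surjective_pairing exy; congr (_, _); apply/eqP.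
  rewrite -subr_eq0; apply/eqP/H0.
  have /asboolP Hx := valP x; have /asboolP Hy := valP y.
  have := submoduleB sH Hx Hy.
  by rewrite [val x]surjective_pairing [val y]surjective_pairing exy -[_ - _]/(_, _) /= subrr.
have [h hh] := hG _ _ f g finj.
exists h => n w Hnw; have Hm : (n, w) \in submodule_pred sH by apply/asboolP.
exact: (hh (exist _ (n, w) Hm : M)).
Qed.

Lemma baer (E : lmodType R) :
  (forall H : set (R^o * E), submodule H -> (forall w, H (0, w) -> w = 0) ->
     exists g : E, forall r w, H (r, w) -> w = (r : R) *: g) ->
  injective_module E.
Proof.
move=> hE M N f g finj.
pose K0 := [set x : N * E | exists m, x = (f m, g m)].
have sK0 : submodule K0.
  split; first by exists 0; rewrite !linear0.
  by move=> r _ _ [m ->] [n ->]; exists (r *: m + n); rewrite !linearP.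
have [|K [sK K0K Kfun Kmax]] := @maximal_submodule _ _ K0
  [set x | x.1 = 0 -> x.2 = 0] sK0.
  by move=> _ [m ->] /= fm0; rewrite (finj m 0) ?linear0.
have Kdom n : exists w, K (n, w).
  (* The conductor of n into the domain of [K], with the map induced by [K]; an e representing it
     allows (n, e) to be adjoined to [K]. *)
  pose H := [set x : R^o * E | K ((x.1 : R) *: n, x.2)].
  have sH : submodule H.
    split; first by rewrite /H /= scale0r; exact: sK.1.
    move=> r [a v] [b w] /= Ha Hb; rewrite /H /=.
    have -> : ((r * a + b : R) *: n, r *: v + w) = r *: ((a : R) *: n, v) + ((b : R) *: n, w) :> N * E.
      by rewrite scalerDl -scalerA.
    exact: sK.2.
  have [w|e He] := hE H sH.
    by rewrite /H /= scale0r => /Kfun /= ->.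
  exists e; apply: Kmax => -[n' w] r Kn' /= n0.
  have : H (- r, w).
    by rewrite /H /= scaleNr -(eqP (_ : n' == - (r *: n))) // -addr_eq0 n0.
  by move=> /He ->; rewrite scaleNr addNr.
pose h0 n := projT1 (cid (Kdom n)).
have hK n : K (n, h0 n) by rewrite /h0; case: cid.
have Kuniq n w : K (n, w) -> h0 n = w.
  move=> Kw; apply/eqP; rewrite -subr_eq0; apply/eqP.
  by apply: (Kfun _ (submoduleB sK (hK n) Kw)); rewrite /= subrr.
have hl : linear h0 by move=> r x y; apply: Kuniq; apply: (sK.2 r _ _ (hK x) (hK y)).
pose h : {linear N -> E} := HB.pack h0 (GRing.isLinear.Build _ _ _ _ _ hl).
exists h => m; rewrite /h /=.
by apply: Kuniq; apply: K0K; exists m.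
Qed.

End Extension.

(** * Splitting off torsion-free summands *)

Section Decomposition.
Variables (R : comPzRingType) (G : lmodType R).
Hypothesis hG : injective_module G.

(* A maximal U-torsion-free submodule C of p(G) is closed under essential       *)
(* extensions in p(G), hence a direct summand: extend the projection            *)
(* B + C -> C, where B is maximal with B meeting C trivially.                   *)
Lemma split_torsion_free (p : {linear G -> G}) (U : set R) :
  (forall z, p (p z) = p z) ->
  exists e : {linear G -> G},
    [/\ forall z, e (e z) = e z,
        forall z, p (e z) = e z,
        forall z, e (p z) = e z,
        forall u z, U u -> u *: e z = 0 -> e z = 0 &
        forall z, p z = z -> e z = 0 -> z != 0 ->
          exists r u, [/\ U u, r *: z != 0 & u *: (r *: z) = 0]].
Proof.
move=> pp.
have [|C [sC _ CPhi Cmax]] := @maximal_submodule _ _ [set 0]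
  [set z : G | p z = z /\ forall u, U u -> u *: z = 0 -> z = 0]
  (submodule_zero G).
  by move=> _ ->; split; [exact: linear0|].
have [|B [sB _ BPhi Bmax]] := @maximal_submodule _ _ [set 0]
  [set z : G | p z = z /\ (C z -> z = 0)] (submodule_zero G).
  by move=> _ ->; split; [exact: linear0|].
(* The graph of the projection b + c -> c. *)
pose H := [set x : G * G | C x.2 /\ B (x.1 - x.2)].
have sH : submodule H.
  split; first by split; [exact: sC.1|rewrite /= subr0; exact: sB.1].
  move=> r x y [Cx Bx] [Cy By]; split; first exact: sC.2.
  have -> : (r *: x + y).1 - (r *: x + y).2 = r *: (x.1 - x.2) + (y.1 - y.2).
    by rewrite /= scalerBr opprD addrACA.
  exact: sB.2.
have [w [/= Cw]|e0 he0] := injective_extension hG sH.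
  rewrite sub0r => /(submoduleZ (-1) sB); rewrite scaleN1r opprK => /BPhi [_].
  exact.
pose e : {linear G -> G} := (p \o e0 \o p : {linear G -> G}).
have eC c : C c -> e c = c.
  move=> Cc; have [pc _] := CPhi _ Cc; rewrite /e /= pc (he0 c c) //.
  by split=> //=; rewrite subrr; exact: sB.1.
have eB b : B b -> e b = 0.
  move=> Bb; have [pb _] := BPhi _ Bb; rewrite /e /= pb (he0 b 0) ?linear0 //.
  by split; [exact: sC.1|rewrite /= subr0].
have pe z : p (e z) = e z by rewrite /e /= pp.
have ep z : e (p z) = e z by rewrite /e /= pp.
clearbody e.
(* If u kills e z, then B + Rz still meets the torsion-free C trivially, so z is in B. *)
have etf z u : p z = z -> U u -> u *: e z = 0 -> e z = 0.
  move=> pz Uu uez; apply: contrapT => ez; apply: (ez); apply: (eB); apply: Bmax.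
  move=> b r Bb; have [pb _] := BPhi _ Bb.
  split; first by rewrite linearD linearZ /= pb pz.
  move=> Cc; have ec : e (b + r *: z) = r *: e z.
    by rewrite linearD eB // add0r linearZ.
  have [_] := CPhi _ Cc; apply=> //; first exact: Uu.
  by rewrite -(eC _ Cc) ec scalerA mulrC -scalerA uez scaler0.
have Ce z : p z = z -> C (e z).
  move=> pz; apply: Cmax => c r Cc; have [pc ctf] := CPhi _ Cc.
  split; first by rewrite linearD linearZ /= pc pe.
  move=> u Uu; rewrite -(eC _ Cc) -linearZ -linearD; apply: etf => //.
  by rewrite linearD linearZ /= pc pz.
have {}Ce z : C (e z) by rewrite -ep; apply: Ce; rewrite pp.
exists e; split=> // [z|u z Uu|z pz ez z0].
- exact: eC.
- by rewrite -ep; apply: etf; rewrite ?pp.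
(* With no such multiple of z, C + Rz would be U-torsion-free, so z would lie in C, where e is the
   identity. *)
apply: contrapT => nz; move: z0; rewrite -ez eC ?eqxx //.
apply: Cmax => c r Cc; have [pc ctf] := CPhi _ Cc.
split; first by rewrite linearD linearZ /= pc pz.
move=> u Uu h.
have c0 : c = 0.
  apply: (ctf u Uu); rewrite -[c](eC _ Cc) -linearZ.
  have -> : u *: c = u *: (c + r *: z) - u *: (r *: z).
    by rewrite scalerDr addrK.
  by rewrite h sub0r linearN !linearZ /= ez oppr0 !scaler0.
move: h; rewrite c0 add0r => h; apply/eqP; apply: contrapT => /negP rz.
by apply: nz; exists r, u.
Qed.

(** Each stage splits f off the remainder p. What p - f fixes is fixed by p and killed by f, so the
    earlier conditions persist. *)
Lemma torsion_free_decomposition (U : nat -> set R) n :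
  exists (e : nat -> {linear G -> G}) (p : {linear G -> G}),
    [/\ forall i z, (i < n)%N -> e i (e i z) = e i z,
        forall i u z, (i < n)%N -> U i u -> u *: e i z = 0 -> e i z = 0,
        forall z, p (p z) = p z,
        forall z i, (i < n)%N -> p z = z -> z != 0 ->
          exists r u, [/\ U i u, r *: z != 0 & u *: (r *: z) = 0] &
        forall z, z = \sum_(i < n) e i z + p z].
Proof.
elim: n => [|n [e [p [ee etf pp hp sum]]]].
  exists (fun=> idfun), idfun; split=> // z.
  by rewrite big_ord0 add0r.
have [f [ff pf fp ftf fmax]] := split_torsion_free (U n) pp.
have pfp z : (p \- f) z = z -> p z = z /\ f z = 0.
  move=> /= ez; split; first by rewrite -[in LHS]ez linearB /= pp pf.
  by rewrite -[in LHS]ez linearB /= fp ff subrr.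
exists (fun i => if i == n then f else e i), (p \- f : {linear G -> G}).
split=> [i z|i u z|z|z i|z].
- by rewrite ltnS leq_eqVlt; case: eqP => [_ _|_] //= /ee.
- by rewrite ltnS leq_eqVlt; case: eqP => [-> _ /ftf|_ /= /etf]; apply.
- by rewrite /= !linearB /= pp pf fp ff !(subrr, oppr0, subr0, addr0).
- rewrite ltnS leq_eqVlt => /predU1P[->|ltin] /pfp [pz fz] z0.
    exact: fmax.
  exact: hp.
rewrite big_ord_recr /= eqxx -addrA [f z + _]addrC subrK.
by under eq_bigr => i _ do rewrite (ltn_eqF (ltn_ord i)).
Qed.

End Decomposition.

(** * Extending maps into G modulo S-torsion *)

Section Torsion.
Variables (R : idomainType) (S : mulrClosed R) (G : lmodType R).

Lemma injective_divisible (a : R) (z : G) :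
  injective_module G -> a != 0 -> exists g, a *: g = z.
Proof.
move=> hG a0; pose H := [set x : R^o * G | exists r : R, x = (r * a, r *: z)].
have sH : submodule H.
  split; first by exists 0; rewrite mul0r scale0r.
  move=> r _ _ [s ->] [t ->]; exists (r * s + t).
  by rewrite mulrDl -mulrA scalerDl -scalerA.
have [w [r [/esym/eqP]]|h hh] := injective_extension hG sH.
  by rewrite mulf_eq0 (negPf a0) orbF => /eqP -> ->; rewrite scale0r.
exists (h 1); rewrite -linearZ; apply: hh.
by exists 1; rewrite scale1r mul1r /GRing.scale /= mulr1.
Qed.

Definition torsion : set G := [set z | exists2 s, s \in S & s *: z = 0].

Lemma torsion_submodule : submodule torsion.
Proof.
split; first by exists 1; rewrite ?rpred1 ?scaler0.
move=> r x y [s Ss sx] [t St ty]; exists (s * t); first exact: rpredM.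
have -> : (s * t) *: (r *: x + y) = (r * t) *: (s *: x) + s *: (t *: y).
  by rewrite scalerDr !scalerA; congr (_ *: _ + _); ring.
by rewrite sx ty !scaler0 addr0.
Qed.

Lemma torsion_linear (e : {linear G -> G}) z : torsion z -> torsion (e z).
Proof. by move=> [s Ss sz]; exists s => //; rewrite -linearZ sz linear0. Qed.

Lemma torsionZ s z : s \in S -> torsion (s *: z) -> torsion z.
Proof.
move=> Ss [t St tz]; exists (t * s); first exact: rpredM.
by rewrite -scalerA.
Qed.

(* Y is the graph of a homomorphism from an ideal of R to G modulo its          *)
(* S-torsion, and [extends e] says that its composite with e extends to R.      *)
Variable Y : set (R^o * G).
Hypotheses (hG : injective_module G) (sY : submodule Y).
Hypothesis YT : forall z, Y (0, z) -> torsion z.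

Definition extends (e : G -> G) :=
  exists g : G, forall (x : R) z, Y (x, z) -> torsion (e z - x *: g).

Lemma graph_torsion (x x' k k' : R) z z' :
  Y (x, z) -> Y (x', z') -> k * x = k' * x' -> torsion (k *: z - k' *: z').
Proof.
move=> Yx Yx' kk; apply: YT.
have := submoduleB sY (submoduleZ k sY Yx) (submoduleZ k' sY Yx').
by rewrite -[_ - _]/(k * x - k' * x', k *: z - k' *: z') kk subrr.
Qed.

Variables (V : set R) (e : {linear G -> G}).
Hypotheses (ee : forall z, e (e z) = e z).
Hypothesis (etf : forall u z, V u -> u *: e z = 0 -> e z = 0).

Lemma torsion_V u z : V u -> torsion (u *: e z) -> torsion (e z).
Proof.
move=> Vu [s Ss suz]; exists s => //; rewrite -linearZ; apply: (etf Vu).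
by rewrite linearZ /= scalerA mulrC -scalerA.
Qed.

Lemma extends_principal (x0 : R) z0 : x0 != 0 -> Y (x0, z0) ->
  (forall x z, Y (x, z) ->
     exists s u r, [/\ s \in S, V u & u * s * x = r * x0]) ->
  extends e.
Proof.
move=> x00 Y0 H; have [g0 g0z] := injective_divisible z0 hG x00.
exists (e g0) => x z Yx; rewrite -linearZ -linearB.
have [s [u [r [Ss Vu eq]]]] := H x z Yx.
apply: (torsionZ Ss); rewrite -linearZ; apply: (torsion_V Vu).
rewrite -linearZ; apply: torsion_linear.
have := graph_torsion Yx Y0 eq.
by rewrite -g0z !scalerA -eq -!scalerA -scalerBr -scalerBr.
Qed.

Hypotheses (V1 : V 1) (VM : forall u v, V u -> V v -> V (u * v)) (V0 : ~ V 0).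
Hypothesis Vval : forall x y : R,
  exists u r, V u /\ (u * x = r * y \/ u * y = r * x).

Lemma V_inj u w : V u -> e w = w -> u *: w = 0 -> w = 0.
Proof. by move=> Vu <-; exact: etf. Qed.

(* The pullback to R of the intersection of the ideals generated by s in S,     *)
(* in the localization of R at V: it kills the S-torsion of e(G).               *)
Definition kill : set R :=
  [set c | forall s, s \in S -> exists u r, V u /\ u * c = r * s].

Lemma killD c d : kill c -> kill d -> kill (c + d).
Proof.
move=> Kc Kd s Ss; have [u [r [Vu uc]]] := Kc s Ss.
have [v [t [Vv vd]]] := Kd s Ss; exists (u * v), (v * r + u * t).
split; first exact: VM.
by rewrite mulrDr mulrDl -[v * r * s]mulrA -uc -[u * t * s]mulrA -vd; ring.
Qed.

Lemma killM c d : kill c -> kill (d * c).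
Proof.
move=> Kc s Ss; have [u [r [Vu uc]]] := Kc s Ss; exists u, (d * r).
by split=> //; rewrite mulrCA uc mulrA.
Qed.

Lemma kill_torsion c z : kill c -> torsion z -> c *: e z = 0.
Proof.
move=> Kc [s Ss sz]; have [u [r [Vu uc]]] := Kc s Ss.
rewrite -linearZ; apply: (etf Vu).
by rewrite -linearZ scalerA uc -scalerA sz scaler0 linear0.
Qed.

(* [lift y x w] : w is the only possible value at x of a lift to e(G) of the    *)
(* homomorphism with graph Y, given that x = (c / u) y.1 with c in [kill].      *)
Definition lift (y : R * G) (x : R) (w : G) :=
  exists u c, [/\ V u, kill c, u * x = c * y.1 & u *: w = c *: e y.2].

(** Passing from y to y' changes the value only by torsion, which c kills. *)
Lemma lift_change (y y' : R * G) (v r : R) x w : Y y -> Y y' ->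
  V v -> v * y.1 = r * y'.1 -> lift y x w -> lift y' x w.
Proof.
case: y y' => [y z] [y' z'] /= Yy Yy' Vv vr [u [c [Vu Kc ux uw]]].
exists (v * u), (r * c); split; [exact: VM|exact: killM| |].
  by rewrite -mulrA ux /= mulrCA vr /=; ring.
rewrite -scalerA uw /= [LHS]scalerA [v * c]mulrC [r * c]mulrC -2!scalerA.
apply/eqP; rewrite -subr_eq0 -scalerBr -!linearZ -linearB; apply/eqP.
exact: kill_torsion (graph_torsion Yy Yy' vr).
Qed.

Lemma lift_linear y r x w x' w' :
  lift y x w -> lift y x' w' -> lift y (r * x + x') (r *: w + w').
Proof.
move=> [u [c [Vu Kc ux uw]]] [v [d [Vv Kd vx vw]]].
exists (u * v), (r * v * c + u * d); split.
- exact: VM.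
- by apply: killD; apply: killM.
- transitivity (r * v * (u * x) + u * (v * x')); first by ring.
  by rewrite ux vx; ring.
rewrite scalerDr scalerDl -2!scalerA -[in RHS]scalerA -uw -[u * d *: _]scalerA -vw.
by rewrite !scalerA; congr (_ *: _ + _); ring.
Qed.

Lemma extends_nonprincipal :
  (forall x, Y x -> exists2 y, Y y &
     exists u c, [/\ V u, kill c & u * x.1 = c * y.1]) ->
  extends e.
Proof.
move=> H.
pose L := [set x : R^o * G | e x.2 = x.2 /\ exists2 y, Y y & lift y x.1 x.2].
have sL : submodule L.
  split.
    split=> /=; first exact: linear0.
    exists 0; first exact: sY.1.
    exists 1, 0; split=> //; last by rewrite scale0r scaler0.
      by move=> s Ss; exists 1, 0; rewrite mulr0 mul0r.
    by rewrite mulr0 mul0r.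
  move=> r [x w] [x' w'] [/= ew [y Yy ly]] [/= ew' [y' Yy' ly']].
  split; first by rewrite /= linearP ew ew'.
  have [v [t [Vv [vt|vt]]]] := Vval y.1 y'.1.
    exists y' => //; apply: lift_linear => //; exact: lift_change vt ly.
  exists y => //; apply: lift_linear => //; exact: lift_change vt ly'.
(* At x = 0 either c = 0, or y = 0 and z is torsion, hence killed by c; in both cases w = 0. *)
have [w [/= ew [[y z] Yy [u [c [Vu Kc]]]]]|h hh] := injective_extension hG sL.
  rewrite mulr0 /= => /esym/eqP; rewrite mulf_eq0 => /orP[] /eqP h0 uw.
    by apply: (V_inj Vu ew); rewrite uw h0 scale0r.
  apply: (V_inj Vu ew); rewrite uw; apply: kill_torsion Kc _.
  by apply: YT; rewrite -h0.
exists (h 1) => x z Yx; have [[y z'] Yy [u [c [Vu Kc eq]]]] := H _ Yx.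
have u0 : u != 0 by apply/eqP => u0; apply: V0; rewrite -u0.
have [w0 uw0] := injective_divisible (e z') hG u0.
(* The value (c/u) e(z'), available because G is divisible by u. *)
pose w := c *: e w0.
have uw : u *: w = c *: e z' by rewrite /w scalerA mulrC -scalerA -[u *: e w0]linearZ uw0 ee.
have ew : e w = w by rewrite /w linearZ /= ee.
have -> : x *: h 1 = w.
  rewrite -linearZ; apply: hh; split=> //=; exists (y, z') => //.
  by exists u, c; split=> //; rewrite /GRing.scale /= mulr1.
rewrite -ew -linearB; apply: (torsion_V Vu).
rewrite -linearZ scalerBr uw -linearZ linearB ee -linearB.
exact: torsion_linear (graph_torsion Yx Yy eq).
Qed.

(** The cases are whether or not one element generates the domain of [Y] after inverting both V and
    S. *)
Lemma extends_valuation : extends e.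
Proof.
have [[[x0 z0] [Y0 H]]|nP] := pselect (exists y0, Y y0 /\ forall x, Y x ->
  exists s u r, [/\ s \in S, V u & u * s * x.1 = r * y0.1]).
  have [x00|] := eqVneq x0 0.
    exists 0 => x z Yx; have [s [u [r [Ss Vu /= eq]]]] := H _ Yx.
    rewrite scaler0 subr0; apply: (torsionZ Ss); rewrite -linearZ.
    apply: (torsion_V Vu); rewrite -linearZ scalerA; apply: torsion_linear.
    have := graph_torsion Yx Y0 eq; rewrite x00 in Y0.
    move=> /(submoduleD torsion_submodule); move/(_ (r *: z0)); rewrite subrK.
    by apply; apply: submoduleZ torsion_submodule (YT Y0).
  by move=> x00; apply: (extends_principal x00 Y0) => x z; exact: (H (x, z)).
apply: extends_nonprincipal => x Yx.
apply: contrapT => nx; apply: nP; exists x; split=> // y Yy.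
apply: contrapT => ny.
have [u [c [Vu [ux|ux]]]] := Vval x.1 y.1; last first.
  by apply: ny; exists 1, u, c; rewrite rpred1 mulr1.
apply: nx; exists y => //; exists u, c; split=> // s Ss.
(* If c divided s locally, y would be a multiple of x after inverting S, against the choice of y. *)
have [v [r [Vv [vc|vc]]]] := Vval c s; first by exists v, r.
case: ny; exists s, v, (r * u); split=> //.
by rewrite vc -!mulrA ux.
Qed.

End Torsion.

(** * Maximal ideals and local comparability *)

Lemma is_ideal_principal (R : comPzRingType) (x : R) :
  is_ideal (fun z => `[< exists w, z = w * x >] : bool).
Proof.
split; first by apply/asboolP; exists 0; rewrite mul0r.
move=> r _ _ /asboolP [v ->] /asboolP [w ->]; apply/asboolP.
by exists (r * v + w); rewrite /GRing.scale /=; ring.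
Qed.

Lemma exists_maximal_ideal (R : comPzRingType) (I : set R^o) :
  submodule I -> ~ I 1 ->
  exists2 P : {pred R}, maximal_ideal P & forall x, I x -> x \in P.
Proof.
move=> sI I1; have [|P [sP IP P1 Pmax]] := @maximal_submodule _ _ I [set x | x <> 1] sI.
  by move=> x Ix x1; apply: I1; rewrite -x1.
exists (fun x => `[< P x >]); last by move=> x /IP Px; apply/asboolP.
split.
- split; first by apply/asboolP; exact: sP.1.
  by move=> r x y /asboolP Px /asboolP Py; apply/asboolP; apply: sP.2.
- by apply/asboolP => /P1.
move=> J [_ Jlin] J1 PJ z Jz; apply/asboolP/Pmax => a r Pa /= ar1.
case/negP: J1; rewrite -ar1 addrC; apply: Jlin => //.
by apply: PJ; apply/asboolP.
Qed.

Lemma valuation_comparable (R : comPzRingType) (P : {pred R})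
    (hP : maximal_ideal P) :
  valuation_ring (loc_at_maximal hP) ->
  forall x y : R,
    exists u r, u \notin P /\ (u * x = r * y \/ u * y = r * x).
Proof.
move=> hv.
pose L := loc_at_maximal hP.
pose q (x : R) : L := Localization.frac (M := R^o) x Localization.den1.
have key x y : (exists w, q x = w * q y) -> exists u r, u \notin P /\ u * x = r * y.
  move=> [w]; elim/Localization.frac_ind: w => b s.
  have -> : (Localization.frac b s : L) * q y =
      Localization.frac (M := R^o) (b * y) (Localization.denM s Localization.den1) :> L.
    exact: (@Localization.fracM R _ b y s Localization.den1).
  move=> /Localization.fracP [t Pt]; rewrite /= /GRing.scale /= mulr1 => eq.
  exists (t * sval s), (t * b); split; last by rewrite -mulrA eq mul1r mulrA.
  exact: (rpredM Pt (valP s)).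
move=> x y.
have inI z : z \in ((fun t => `[< exists w, t = w * z >]) : {pred L}).
  by apply/asboolP; exists 1; rewrite mul1r.
have [/(_ _ (inI (q x)))|/(_ _ (inI (q y)))] :=
  hv _ _ (is_ideal_principal (q x)) (is_ideal_principal (q y)).
  by move=> /asboolP /key [u [r [Pu e]]]; exists u, r; split=> //; left.
by move=> /asboolP /key [u [r [Pu e]]]; exists u, r; split=> //; right.
Qed.

(** Treat one index at a time; by commutativity a further multiple stays killed by the earlier
    annihilators. *)
Lemma killed_common_multiple (R : comPzRingType) (G : lmodType R) (U : nat -> set R)
    (A : set G) n z :
  (forall r z, A z -> A (r *: z)) -> A z -> z != 0 ->
  (forall z i, (i < n)%N -> A z -> z != 0 ->
     exists r u, [/\ U i u, r *: z != 0 & u *: (r *: z) = 0]) ->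
  exists r, r *: z != 0 /\
    forall i, (i < n)%N -> exists2 u, U i u & u *: (r *: z) = 0.
Proof.
move=> AZ Az z0; elim: n => [|n IH] H.
  by exists 1; rewrite scale1r.
have [|r [rz0 Hr]] := IH; first by move=> y i /ltnW; exact: H.
have [s [u [Uu srz urz]]] := H _ n (leqnn _) (AZ r _ Az) rz0.
exists (s * r); rewrite -scalerA; split=> // i.
rewrite ltnS leq_eqVlt => /predU1P[->|/Hr[v Uv vz]]; first by exists u.
exists v => //; rewrite [s *: _]scalerA scalerA [v * _]mulrC -!mulrA -scalerA.
by rewrite [r * v]mulrC -scalerA vz scaler0.
Qed.

(** * Assembling the extensions *)

Theorem theorem10 (R : idomainType) (hR : prufer_domain R)
    (hfin : finite_character R) (G : lmodType R) (hG : injective_module G)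
    (S : mulrClosed R) :
  injective_module (loc_module S G).
Proof.
apply: baer => H sH H0.
pose q (z : G) : loc_module S G := Localization.frac z Localization.den1.
have qP z z' : torsion S (z - z') -> q z = q z'.
  move=> [s Ss sz]; apply/Localization.fracP; exists s => //=.
  by apply/eqP; rewrite -subr_eq0 !scale1r -scalerBr sz.
have q0 z : q z = 0 -> torsion S z.
  move=> /Localization.fracP [s Ss /=]; rewrite scaler0 scaler0 scale1r => sz.
  by exists s.
have qlin r z z' : q (r *: z + z') = r *: q z + q z'.
  rewrite [r *: q z](Localization.fracZ r z Localization.den1).
  rewrite Localization.frac_addE; apply: Localization.frac_eq => /=.
  by rewrite !scale1r mulr1 scale1r.
have qsurj w : exists z, w = q z.
  elim/Localization.frac_ind: w => m [s Ss].
  have [s0|s0] := eqVneq s 0.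
    exists 0; apply/Localization.fracP; exists 0; first by rewrite -s0.
    by rewrite !scale0r.
  have [z <-] := injective_divisible m hG s0.
  by exists z; apply: Localization.frac_eq; rewrite /= scale1r.
pose Y := [set x : R^o * G | H (x.1, q x.2)].
have sY : submodule Y.
  split; first by rewrite /Y /=; exact: sH.1.
  by move=> r x y Yx Yy; rewrite /Y /= qlin; apply: (sH.2 r _ _ Yx Yy).
have YT z : Y (0, z) -> torsion S z by move=> /H0 /q0.
suff [g hg] : extends S Y idfun.
  exists (q g) => r w; have [z ->] := qsurj w => Hz.
  rewrite -[RHS]addr0 -[0 in RHS](_ : q 0 = 0) // -qlin addr0.
  by apply: qP; exact: hg.
have [[a [za [a0 Ya]]]|nY] := pselect (exists (a : R) za, a != 0 /\ Y (a, za)); last first.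
  exists 0 => x z Yx; rewrite scaler0 subr0; apply: YT.
  suff <- : x = 0 by [].
  by apply: contrapT => /eqP x0; apply: nY; exists x, z.
have /(@finite_seqP {classic (R -> bool)})[s hs] := hfin a a0.
pose P i : R -> bool := nth (fun=> false) s i.
have Pmax i : (i < size s)%N -> maximal_ideal (P i) /\ a \in P i.
  move=> lti; suff : [set P : R -> bool | maximal_ideal P /\ a \in P] (P i) by [].
  rewrite hs; exact: (@mem_nth {classic (R -> bool)}).
(* Index 0 is reserved for a, so the ideal [P j] has index j + 1. *)
pose U i : set R := if i is j.+1 then [set u | u \notin P j] else [set a].
have [e [p [ee etf pp hp sum]]] := torsion_free_decomposition hG U (size s).+1.
have p0 z : p z = 0.
  apply/eqP; apply: contrapT => /negP pz0.
  have [||//||r [rz0 hr]] := @killed_common_multiple R G U [set z | p z = z] (size s).+1 (p z).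
  - by move=> r y /= py; rewrite linearZ /= py.
  - by rewrite /= pp.
  - by move=> y i lti /= py; exact: hp.
  (* This proper annihilator contains a, so some [P i] would contain it; yet it has an element
     outside every [P i]. *)
  pose I := [set x : R^o | (x : R) *: (r *: p z) = 0].
  have [||Q Qmax IQ] := @exists_maximal_ideal R I.
  - split; first by rewrite /I /= scale0r.
    move=> t x y Ix Iy; rewrite /I /= scalerDl.
    by rewrite -[((t : R) *: x : R)]/(t * x) -scalerA Ix Iy scaler0 addr0.
  - by rewrite /I /= scale1r; exact/eqP.
  have [_ -> Ia] := hr 0%N isT.
  have : [set P : R -> bool | maximal_ideal P /\ a \in P] (Q : R -> bool).
    by split=> //; apply: IQ.
  rewrite hs /= => /(@nthP {classic (R -> bool)} _ _ (fun=> false)) [i lti PiQ].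
  have [u] := hr i.+1 lti.
  by rewrite /U /= /P PiQ => /negP uQ /IQ.
have ext i : (i < (size s).+1)%N -> extends S Y (e i).
  case: i => [|i] lti.
    apply: (extends_principal hG sY YT (fun u z => etf 0%N u z lti) a0 Ya).
    by move=> x z Yx; exists 1, a, x; rewrite rpred1 mulr1 mulrC.
  have [Pm Pa] := Pmax i lti.
  have [P1 PM] := maximal_ideal_compl_mulr_closed Pm.
  apply: (@extends_valuation R S G Y hG sY YT (U i.+1)) => //.
  - by move=> z; exact: ee.
  - by move=> u z; exact: etf.
  - by have [[P0 _] _ _] := Pm; apply/negP; rewrite negbK.
  - move=> x y; have [u [r [Pu h]]] := valuation_comparable (hR _ Pm) x y.
    by exists u, r.
have : forall n, (n <= (size s).+1)%N -> extends S Y (fun z => \sum_(i < n) e i z).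
  elim=> [_|n IH ltn].
    exists 0 => x z _; rewrite big_ord0 scaler0 subr0; exact: (torsion_submodule S G).1.
  have [g hg] := IH (ltnW ltn); have [g' hg'] := ext n ltn.
  exists (g + g') => x z Yx; rewrite big_ord_recr /= scalerDr opprD addrACA.
  by apply: submoduleD (torsion_submodule S G) _ _; [exact: hg|exact: hg'].
move=> /(_ _ (leqnn _)) [g hg]; exists g => x z Yx /=.
by rewrite {1}(sum z) p0 addr0; exact: hg.
Qed.
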